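(* Let $m,n\ge 1$ be integers and let $A\in\mathbb{R}^{n(m+1)\times(mn)}$ be the block matrix $$A=\begin{bmatrix} -I_n\ \ -I_n\ \ -I_n\ \cdots\ -I_n\\ I_{mn} \end{bmatrix},$$ whose first $n$ rows consist of $m$ copies of $-I_n$ placed side by side and whose remaining $mn$ rows form the identity matrix $I_{mn}$. Then $A$ is totally unimodular.
   Context: $I_n$ and $I_{mn}$ are the identity matrices of sizes $n$ and $mn$. A matrix is totally unimodular if each of its square submatrices has determinant $0$, $1$ or $-1$. The matrix $A$ is the system matrix (without sign constraints and integer requirements) of the non-expendable resource allocation problem, with variables $x_{ij}$ ($1\le i\le m$, $1\le j\le n$) ordered as $(x_{11},\dots,x_{1n},x_{21},\dots,x_{mn})$: the first $n$ rows encode the demand constraints $\sum_{i=1}^m x_{ij}\ge d_j$ (multiplied by $-1$), and the remaining $mn$ rows encode upper bounds on the individual variables $x_{ij}$ given by relief centre capacities. *)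

(* Defs.v *)
From mathcomp Require Import all_boot all_algebra.
From mathcomp Require Import reals.

Set Implicit Arguments.
Unset Strict Implicit.
Unset Printing Implicit Defensive.

Import GRing.Theory.
Local Open Scope ring_scope.

(* A k x k submatrix is obtained by selecting k rows and k columns, listed in
   increasing order by the strictly increasing maps f and g. *)
Definition totally_unimodular (R : comNzRingType) (p q : nat)
    (A : 'M[R]_(p, q)) : Prop :=
  forall (k : nat) (f : 'I_k -> 'I_p) (g : 'I_k -> 'I_q),
    {homo f : i j / (i < j)%N} -> {homo g : i j / (i < j)%N} ->
    \det (mxsub f g A) \in [:: 0; 1; -1].

Lemma sum_blocks (m n : nat) : (\sum_(i < m) n = m * n)%N.
Proof. by rewrite sum_nat_const card_ord. Qed.

Lemma add_blocks (m n : nat) : (n + \sum_(i < m) n = n * (m + 1))%N.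
Proof. by rewrite sum_blocks addn1 mulnS mulnC. Qed.

(* The casts only turn the sizes computed from the blocks, n + \sum_(i < m) n
   and \sum_(i < m) n, into n * (m + 1) and m * n. *)
Definition allocation_mx (R : comNzRingType) (m n : nat) :
    'M[R]_(n * (m + 1), m * n) :=
  castmx (add_blocks m n, sum_blocks m n)
    (col_mx (\mxrow_(i < m) (- 1%:M : 'M[R]_n)) 1%:M).

(* Main.v *)
(* Every submatrix of A splits its rows into identity rows, with at most one
   nonzero entry each, and demand rows, among which each column has at most one
   nonzero entry.  Expanding the determinant along an identity row, or along
   any column when only demand rows are left, leaves 0 or, up to sign, a minor
   of the same shape, so induction on the size applies. *)
Require Import Defs.
From mathcomp Require Import all_boot all_algebra.
From mathcomp Require Import reals.

Set Implicit Arguments.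
Unset Strict Implicit.
Unset Printing Implicit Defensive.

Import GRing.Theory.
Local Open Scope ring_scope.

Lemma mem_sign3M (R : nzRingType) (x y : R) :
  x \in [:: 0; 1; -1] -> y \in [:: 0; 1; -1] -> x * y \in [:: 0; 1; -1].
Proof.
rewrite !inE => /or3P[] /eqP-> /or3P[] /eqP->;
  by rewrite ?(mul0r, mulr0, mul1r, mulr1, mulN1r, opprK) eqxx ?orbT.
Qed.

Lemma mem_sign3_sign (R : nzRingType) (e : nat) :
  (-1) ^+ e \in [:: 0; 1; -1 : R].
Proof. by rewrite -signr_odd; case: odd; rewrite !inE eqxx ?orbT. Qed.

Lemma det_row_single (R : comNzRingType) (k : nat) (M : 'M[R]_k) i j :
  (forall j', j' != j -> M i j' = 0) -> \det M = M i j * cofactor M i j.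
Proof.
move=> M0; rewrite (expand_det_row M i) (bigD1 j) //= big1 ?addr0 // => j' /M0->.
by rewrite mul0r.
Qed.

(** [b] marks the demand-type rows. Sparsity is phrased as uniqueness of nonzero positions, a form
    that passes directly to minors and so suits induction on [k]. *)
Lemma det_sparse (R : comNzRingType) (k : nat) (M : 'M[R]_k) (b : pred 'I_k) :
  (forall i j, M i j \in [:: 0; 1; -1]) ->
  (forall i j j', ~~ b i -> M i j != 0 -> M i j' != 0 -> j = j') ->
  (forall i i' j, b i -> b i' -> M i j != 0 -> M i' j != 0 -> i = i') ->
  \det M \in [:: 0; 1; -1].
Proof.
elim: k => [|k IHk] in M b *; first by rewrite det_mx00 !inE eqxx orbT.
move=> M3 rowM colM.
(* Deleting row [i] and column [j] relabels indices by [lift], whose injectivity carries uniqueness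
   over to the minor, with marking [b \o lift i]. *)
have cofM i j : cofactor M i j \in [:: 0; 1; -1].
  apply: mem_sign3M; first exact: mem_sign3_sign.
  apply: (IHk _ (b \o lift i)) => [i' j'|i' j1 j2|i1 i2 j'] /=.
  - by rewrite !mxE.
  - by rewrite !mxE => bi' n1 n2; apply/(@lift_inj _ j)/(rowM _ _ _ bi' n1 n2).
  - by rewrite !mxE => b1 b2 n1 n2; apply/(@lift_inj _ i)/(colM _ _ _ b1 b2 n1 n2).
have [i bi|b_all] := pickP (predC b).
  have [j Mij|Mi0] := pickP (fun j => M i j != 0).
    rewrite (@det_row_single _ _ M i j); first exact: mem_sign3M.
    move=> j' j'j; apply/eqP; apply: contraNT j'j => Mij'.
    by apply/eqP/(rowM _ _ _ bi Mij' Mij).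
  rewrite (expand_det_row M i) big1 ?inE ?eqxx // => j _.
  by rewrite (eqP (negbFE (Mi0 j))) mul0r.
have bT i : b i by apply: negbFE (b_all i).
(* All rows are now marked, so every column has at most one nonzero entry; column [0] exists because
   the size is [k.+1]. *)
have [i Mi0|M0] := pickP (fun i => M i 0 != 0).
  rewrite (expand_det_col M 0) (bigD1 i) //= big1 ?addr0; first exact: mem_sign3M.
  move=> i' i'i; suff /eqP-> : M i' 0 == 0 by rewrite mul0r.
  by apply: contraNT i'i => Mi'0; apply/eqP/(colM i' i 0 (bT i') (bT i)).
rewrite (expand_det_col M 0) big1 ?inE ?eqxx // => i _.
by rewrite (eqP (negbFE (M0 i))) mul0r.
Qed.

Lemma ltn_homo_inj (k p : nat) (f : 'I_k -> 'I_p) :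
  {homo f : i j / (i < j)%N} -> injective f.
Proof.
move=> homo_f i j fij; apply: val_inj => /=.
by case: (ltngtP i j) => // ltij; have := homo_f _ _ ltij; rewrite fij ltnn.
Qed.

(** Selecting rows and columns injectively never duplicates a nonzero entry, so each submatrix
    inherits the sparsity pattern, with marking [b \o f]. *)
Lemma totally_unimodular_sparse (R : comNzRingType) (p q : nat)
    (A : 'M[R]_(p, q)) (b : pred 'I_p) :
  (forall i j, A i j \in [:: 0; 1; -1]) ->
  (forall i j j', ~~ b i -> A i j != 0 -> A i j' != 0 -> j = j') ->
  (forall i i' j, b i -> b i' -> A i j != 0 -> A i' j != 0 -> i = i') ->
  totally_unimodular A.
Proof.
move=> A3 rowA colA k f g /ltn_homo_inj f_inj /ltn_homo_inj g_inj.
apply: (@det_sparse _ _ _ (b \o f)) => [i j|i j j'|i i' j] /=; rewrite !mxE //.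
- by move=> bi n1 n2; apply/g_inj/(rowA _ _ _ bi n1 n2).
- by move=> b1 b2 n1 n2; apply/f_inj/(colA _ _ _ b1 b2 n1 n2).
Qed.

Lemma totally_unimodular_castmx (R : comNzRingType) (p q p' q' : nat)
    (eqpq : (p = p') * (q = q')) (A : 'M[R]_(p, q)) :
  totally_unimodular A -> totally_unimodular (castmx eqpq A).
Proof. by case: eqpq => ep eq; case: _ / ep; case: _ / eq. Qed.

Theorem theorem5p2 (R : realType) (m n : nat) (hm : (1 <= m)%N) (hn : (1 <= n)%N) :
  totally_unimodular (allocation_mx R m n).
Proof.
apply: totally_unimodular_castmx.
pose demand_row (i : 'I_(n + \sum_(i < m) n)) :=
  if split i is inl _ then true else false.
apply: (@totally_unimodular_sparse _ _ _ _ demand_row); rewrite /demand_row.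
- move=> i j; rewrite !mxE; case: split => r; rewrite !mxE;
  by case: eqP; rewrite ?oppr0 !inE eqxx ?orbT.
- move=> i j j'; rewrite !mxE; case: split => // r _; rewrite !mxE.
  by case: (r =P j) => [<-|_]; case: (r =P j') => [<-|_]; rewrite ?eqxx.
(* A demand row is nonzero in column [j] only if its index is the position of [j] within its block;
   [r] and [r'] both equal that position. *)
- move=> i i' j; rewrite !mxE; case: (split_ordP i) => // r ->.
  case: (split_ordP i') => // r' -> _ _; rewrite !mxE.
  by case: (r =P _) => [->|_]; case: (r' =P _) => [->|_]; rewrite ?oppr0 ?eqxx.
Qed.
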